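(* Let $(\mathcal{X}_1,\mathcal{X}_2,p(y_2|x_1)p(y_3|x_1,x_2,y_2),\mathcal{Y}_2,\mathcal{Y}_3)$ be a discrete memoryless noncausal relay channel with capacity $C_\infty$. Then \[ C_{\infty} \geq \max \min\{I(X_1;Y_2),\; I(X_1,U;Y_3)-I(U;Y_2|X_1)\}, \] where the maximum is over all pmfs $p(x_1)p(u|x_1,y_2)$ (with $U$ taking values in a finite set) and all functions $x_2(u,x_1,y_2)$, and the mutual informations are evaluated under the joint distribution $p(x_1)p(y_2|x_1)p(u|x_1,y_2)\mathbf{1}\{x_2=x_2(u,x_1,y_2)\}p(y_3|x_1,x_2,y_2)$.
   Context: A discrete memoryless (DM) noncausal relay channel consists of finite alphabets $\mathcal{X}_1,\mathcal{X}_2,\mathcal{Y}_2,\mathcal{Y}_3$ and conditional pmfs $p(y_2|x_1)$ and $p(y_3|x_1,x_2,y_2)$; the sender inputs $X_1$, the relay observes $Y_2$ and inputs $X_2$, the receiver observes $Y_3$. It is memoryless: $p(y_{2i}|x_1^i,y_2^{i-1},m)=p(y_{2i}|x_{1i})$ and $p(y_{3i}|x_1^i,x_2^i,y_2^i,y_3^{i-1},m)=p(y_{3i}|x_{1i},x_{2i},y_{2i})$. A $(2^{nR},n)$ code consists of a message set $[1:2^{nR}]$, an encoder assigning a codeword $x_1^n(m)$ to each message $m$, a relay encoder assigning a symbol $x_{2i}(y_2^n)$ for each $i\in[1:n]$ as a function of the entire received sequence $y_2^n$ (noncausal, i.e., unlimited lookahead), and a decoder assigning an estimate $\hat m(y_3^n)$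 or an error. The message $M$ is uniform over $[1:2^{nR}]$, the error probability is $P_e^{(n)}=\mathbb{P}\{\hat M\neq M\}$, a rate $R$ is achievable if there is a sequence of $(2^{nR},n)$ codes with $P_e^{(n)}\to 0$, and the capacity $C_\infty$ is the supremum of achievable rates. *)

(* Defs.v *)
From HB Require Import structures.
From mathcomp Require Import all_boot all_order all_algebra.
From mathcomp Require Import all_classical all_reals all_analysis.
Set Implicit Arguments. Unset Strict Implicit. Unset Printing Implicit Defensive.
Import Order.TTheory GRing.Theory Num.Theory.
Local Open Scope classical_set_scope.
Local Open Scope ring_scope.

Section Info.
Variable R : realType.

Definition log2 (x : R) : R := ln x / ln 2.

Definition is_pmf (T : finType) (p : T -> R) :=
  (forall t, 0 <= p t) /\ \sum_t p t = 1.

Definition marg (T A : finType) (P : T -> R) (f : T -> A) (a : A) : R :=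
  \sum_(t | f t == a) P t.

(* conditional mutual information I(A;B|C) (in bits) of the random variables
   fa, fb, fc defined on the finite probability space (T, P).
   Terms with P t = 0 contribute 0 (convention 0 log 0 = 0). *)
Definition cmi (T A B C : finType) (P : T -> R)
  (fa : T -> A) (fb : T -> B) (fc : T -> C) : R :=
  \sum_t P t * log2
    (marg P (fun s => (fa s, fb s, fc s)) (fa t, fb t, fc t) * marg P fc (fc t)
     / (marg P (fun s => (fa s, fc s)) (fa t, fc t)
        * marg P (fun s => (fb s, fc s)) (fb t, fc t))).

Definition mi (T A B : finType) (P : T -> R) (fa : T -> A) (fb : T -> B) : R :=
  cmi P fa fb (fun _ => tt).

Variables (X1 X2 Y2 Y3 : finType).

Definition relay_channel (W2 : X1 -> Y2 -> R) (W3 : X1 -> X2 -> Y2 -> Y3 -> R) :=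
  (forall x1, is_pmf (W2 x1)) /\ (forall x1 x2 y2, is_pmf (W3 x1 x2 y2)).

(* A noncausal relay code of blocklength n with M messages:
   encoder m |-> x1^n(m), relay x2i(y2^n), decoder y3^n |-> message or error (None). *)
Record nc_code (n M : nat) := NCCode {
  nc_enc : 'I_M -> {ffun 'I_n -> X1};
  nc_rel : 'I_n -> {ffun 'I_n -> Y2} -> X2;
  nc_dec : {ffun 'I_n -> Y3} -> option 'I_M }.

Definition err_prob (W2 : X1 -> Y2 -> R) (W3 : X1 -> X2 -> Y2 -> Y3 -> R)
  (n M : nat) (c : nc_code n M) : R :=
  (M%:R)^-1 * \sum_(m : 'I_M) \sum_(y2 : {ffun 'I_n -> Y2})
     \sum_(y3 : {ffun 'I_n -> Y3})
     (\prod_(i < n) W2 (nc_enc c m i) (y2 i)) *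
     (\prod_(i < n) W3 (nc_enc c m i) (nc_rel c i y2) (y2 i) (y3 i)) *
     (if nc_dec c y3 == Some m then 0 else 1).

Definition nmsg (Rt : R) (n : nat) : nat := `|Num.ceil (2 `^ (n%:R * Rt))|%N.

Definition achievable W2 W3 (Rt : R) : Prop :=
  0 <= Rt /\
  exists c : forall n : nat, nc_code n (nmsg Rt n),
    (fun n => err_prob W2 W3 (c n) : R^o) @ \oo --> (0 : R^o).

Definition capacity W2 W3 : \bar R :=
  ereal_sup [set (Rt%:E)%E | Rt in achievable W2 W3].

End Info.

(* Main.v *)
Require Import Defs.
From HB Require Import structures.
From mathcomp Require Import all_boot all_order all_algebra.
From mathcomp Require Import all_classical all_reals all_analysis.
From mathcomp Require Import ring lra.
Import Order.TTheory GRing.Theory Num.Theory.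
Local Open Scope ring_scope.
Set Implicit Arguments. Unset Strict Implicit. Unset Printing Implicit Defensive.

(** Random coding with threshold tests on information densities in place of
    typical sets.  Message m gets a random codeword x(m) and, conditionally on
    it, L random words u(m,1), ..., u(m,L).  The relay decodes m from y2, looks
    for an l such that (x(m), u(m,l), y2) has a small density i(U;Y2|X1) and,
    besides, makes the receiver's test fail only with small probability, and
    sends x2 = f(u(m,l), x(m), y2).  The receiver looks for an m such that some
    (x(m), u(m,l)) has a large density with y3.

    Comparing the relay with a genie-aided one that knows m makes y3 depend on
    the row of m only, so that wrong rows are independent of y3.  For every
    fixed y3 a wrong pair passes the test with threshold theta with probability
    at most 1 / theta, whatever the law of y3.  A change of measure bounds the
    probability that no l works.  This yields a one-shot bound, and Chebyshev's
    inequality applied to the sums of single-letter densities concludes. *)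

(** * Independent letters: sums against a product pmf *)

Lemma sum_delta (R : realType) (T : finType) (F : T -> R) (x : T) :
  \sum_t F t * (x == t)%:R = F x.
Proof.
rewrite (bigD1 x) //= eqxx mulr1 big1 ?addr0 // => t tx.
by rewrite eq_sym (negbTE tx) mulr0.
Qed.

Lemma sum_delta_r (R : realType) (T : finType) (F : T -> R) (x : T) :
  \sum_t F t * (t == x)%:R = F x.
Proof. by rewrite -[RHS]sum_delta; apply: eq_bigr => t _; rewrite eq_sym. Qed.

Section ProductLaw.
Variables (R : realType) (I T : finType) (p : T -> R).
Hypothesis hp : is_pmf p.

(** Distributivity of products over sums: the mean of a product of functions of independent
    coordinates factors. *)
Lemma sum_prod_weights (h : I -> T -> R) :
  \sum_(c : {ffun I -> T}) \prod_i p (c i) * \prod_i h i (c i) =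
  \prod_i \sum_t p t * h i t.
Proof.
rewrite bigA_distr_bigA; apply: eq_bigr => c _.
by rewrite -big_split.
Qed.

Lemma sum_prod_pmf : \sum_(c : {ffun I -> T}) \prod_i p (c i) = 1.
Proof.
transitivity (\sum_(c : {ffun I -> T}) \prod_i p (c i) * \prod_(i : I) 1).
  by apply: eq_bigr => c _; rewrite big1_eq mulr1.
rewrite (sum_prod_weights (fun _ _ => 1)) big1 // => i _.
by under eq_bigr do rewrite mulr1; exact: hp.2.
Qed.

Lemma sum_prod_marginal (i : I) (F : T -> R) :
  \sum_(c : {ffun I -> T}) \prod_j p (c j) * F (c i) = \sum_t p t * F t.
Proof.
pose h j t := if j == i then F t else 1.
transitivity (\sum_(c : {ffun I -> T}) \prod_j p (c j) * \prod_j h j (c j)).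
  apply: eq_bigr => c _; congr (_ * _).
  rewrite (bigD1 i) //= {1}/h eqxx big1 ?mulr1 // => j /negbTE ji.
  by rewrite /h ji.
rewrite sum_prod_weights (bigD1 i) //= [X in _ * X]big1 ?mulr1.
  by apply: eq_bigr => t _; rewrite /h eqxx.
move=> j /negbTE ji; rewrite -hp.2; apply: eq_bigr => t _.
by rewrite /h ji mulr1.
Qed.

(** [F] need not be a product, so it is expanded over indicators of pairs of values; each such
    indicator is a product over coordinates and factors. *)
Lemma sum_prod_marginal2 (i j : I) (F : T -> T -> R) : j != i ->
  \sum_(c : {ffun I -> T}) \prod_k p (c k) * F (c i) (c j) =
  \sum_t p t * \sum_s p s * F t s.
Proof.
move=> ji.
have one a b : \sum_(c : {ffun I -> T}) \prod_k p (c k) *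
    ((c i == a)%:R * (c j == b)%:R) = p a * p b.
  pose h k t := if k == i then (t == a)%:R else
                if k == j then (t == b)%:R else 1 : R.
  transitivity (\sum_(c : {ffun I -> T}) \prod_k p (c k) * \prod_k h k (c k)).
    apply: eq_bigr => c _; congr (_ * _).
    rewrite (bigD1 i) //= (bigD1 j) //= big1 ?mulr1.
      by rewrite /h eqxx (negbTE ji) eqxx.
    by move=> k /andP[/negbTE ki /negbTE kj]; rewrite /h ki kj.
  rewrite sum_prod_weights (bigD1 i) //= (bigD1 j) //= [X in _ * (_ * X)]big1.
    rewrite mulr1; congr (_ * _).
      by rewrite -[RHS]sum_delta; apply: eq_bigr => t _; rewrite /h eqxx eq_sym.
    by rewrite -[RHS]sum_delta; apply: eq_bigr => t _; rewrite /h (negbTE ji) eqxx eq_sym.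
  move=> k /andP[/negbTE ki /negbTE kj]; rewrite -hp.2; apply: eq_bigr => t _.
  by rewrite /h ki kj mulr1.
transitivity (\sum_(c : {ffun I -> T}) \sum_a \sum_b F a b *
   (\prod_k p (c k) * ((c i == a)%:R * (c j == b)%:R))).
  apply: eq_bigr => c _; rewrite mulrC -[F _ _](sum_delta (F (c i))).
  rewrite -(sum_delta (fun a => \sum_b F a b * (c j == b)%:R) (c i)).
  rewrite mulr_suml; apply: eq_bigr => a _.
  by rewrite !mulr_suml; apply: eq_bigr => b _; ring.
rewrite exchange_big; apply: eq_bigr => a _ /=.
rewrite exchange_big mulr_sumr; apply: eq_bigr => b _ /=.
by rewrite -mulr_sumr one; ring.
Qed.

End ProductLaw.

(** * Averages under a pmf *)

Lemma mean_ge0 (R : realType) (T : finType) (p F : T -> R) :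
  (forall t, 0 <= p t) -> (forall t, 0 <= F t) -> 0 <= \sum_t p t * F t.
Proof. by move=> p0 F0; apply: sumr_ge0 => t _; apply: mulr_ge0. Qed.

Lemma mean_le (R : realType) (T : finType) (p F G : T -> R) :
  (forall t, 0 <= p t) -> (forall t, F t <= G t) ->
  \sum_t p t * F t <= \sum_t p t * G t.
Proof. by move=> p0 FG; apply: ler_sum => t _; apply: ler_wpM2l. Qed.

Lemma mean_le_cst (R : realType) (T : finType) (p F : T -> R) (a : R) :
  is_pmf p -> (forall t, F t <= a) -> \sum_t p t * F t <= a.
Proof.
move=> [p0 p1] Fa; apply: (le_trans (mean_le p0 Fa)).
by rewrite -mulr_suml p1 mul1r.
Qed.

(** This turns a random codebook into a deterministic one. If every value exceeded [a], the
    nonnegative terms [p t * (F t - a)] would sum to at most 0, forcing [p] to vanish. *)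
Lemma exists_le_mean (R : realType) (T : finType) (p F : T -> R) (a : R) :
  is_pmf p -> \sum_t p t * F t <= a -> exists t, F t <= a.
Proof.
move=> [p0 p1] Ea; apply: contrapT => nex.
have lt t : a < F t by rewrite ltNge; apply/negP => ?; apply: nex; exists t.
have ge0 t : true -> 0 <= p t * (F t - a).
  by move=> _; rewrite mulr_ge0 // subr_ge0 ltW.
have eq0 : \sum_t p t * (F t - a) = 0.
  apply/eqP; rewrite eq_le sumr_ge0 // andbT.
  under eq_bigr do rewrite mulrBr.
  by rewrite sumrB -mulr_suml p1 mul1r subr_le0.
have : \sum_t p t = 0.
  rewrite big1 // => t _; have /eqP := psumr_eq0P ge0 eq0 (erefl : xpredT t).
  by rewrite mulf_eq0 subr_eq0 (gt_eqF (lt t)) orbF => /eqP.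
by rewrite p1 => /eqP; rewrite oner_eq0.
Qed.

(* Bernoulli, then convexity of [a |-> 1 / (1 + a c)] on [0, 1]. *)
Lemma miss_prob_le (R : realType) (g a tau : R) (L : nat) :
  0 < tau -> (0 < L)%N -> 0 <= a <= 1 -> a <= tau * g -> g <= 1 ->
  (1 - g) ^+ L <= 1 - a + tau / L%:R.
Proof.
move=> t0 L0 /andP[a0 a1] ag g1.
have g0 : 0 <= g by rewrite -(pmulr_rge0 _ t0) (le_trans a0).
have Lp : 0 < L%:R :> R by rewrite ltr0n.
have bern (k : nat) : (1 - g) ^+ k * (1 + k%:R * g) <= 1.
  elim: k => [|k IH]; first by rewrite expr0 mul0r addr0 mulr1.
  apply: le_trans IH; rewrite exprSr -mulrA ler_wpM2l ?exprn_ge0 ?subr_ge0 //.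
  rewrite -natr1; have : 0 <= k%:R :> R by []; move=> k0; nra.
have c0 : 0 < L%:R / tau by rewrite divr_gt0.
set c := L%:R / tau in c0 *.
have -> : tau / L%:R = c^-1 by rewrite invf_div.
have acg : a * c <= L%:R * g.
  by rewrite /c mulrA ler_pdivrMr // mulrC -mulrA ler_pM2l // mulrC.
have ac0 : 0 <= a * c by rewrite mulr_ge0 // ltW.
have h1 : (1 - g) ^+ L <= (1 + a * c)^-1.
  rewrite -div1r ler_pdivlMr ?ltr_wpDr //; apply: le_trans (bern L).
  by rewrite ler_wpM2l ?exprn_ge0 ?subr_ge0 // lerD2l.
apply: (le_trans h1); rewrite -div1r ler_pdivrMr ?ltr_wpDr //.
have -> : (1 - a + c^-1) * (1 + a * c) = 1 + a * (1 - a) * c + c^-1.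
  by field; rewrite gt_eqF.
have : 0 < c^-1 by rewrite invr_gt0.
have : 0 <= a * (1 - a) * c by apply: mulr_ge0; [apply: mulr_ge0; rewrite ?subr_ge0|exact: ltW].
lra.
Qed.

(** * One-shot random coding bound for a single use of a relay channel *)

Section OneShot.
Variables (R : realType) (X1 X2 Y2 Y3 U : finType).
Variables (W2 : X1 -> Y2 -> R) (W3 : X1 -> X2 -> Y2 -> Y3 -> R).
Hypothesis hW : relay_channel W2 W3.
Variables (p1 : X1 -> R) (q : X1 -> Y2 -> U -> R) (f : U -> X1 -> Y2 -> X2).
Hypotheses (hp1 : is_pmf p1) (hq : forall x y, is_pmf (q x y)).

(** The induced conditional pmf p(u|x1), from which auxiliary words can be drawn before y2 is
    known. *)
Definition aux_kernel (x : X1) (u : U) : R := \sum_y W2 x y * q x y u.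

Lemma aux_kernel_pmf x : is_pmf (aux_kernel x).
Proof.
split=> [u|].
  by rewrite /aux_kernel mean_ge0 // => y; [exact: (hW.1 x).1|exact: (hq x y).1].
rewrite exchange_big /= -[RHS](hW.1 x).2; apply: eq_bigr => y _.
by rewrite -mulr_sumr (hq x y).2 mulr1.
Qed.

Variables (M L : nat) (m0 : 'I_M) (l0 : 'I_L).

Notation row := (X1 * {ffun 'I_L -> U})%type.
Notation codebook := {ffun 'I_M -> row}.

(** The [L] words of a message are independent only given its codeword, as in superposition
    coding. *)
Definition row_law (t : row) : R := p1 t.1 * \prod_l aux_kernel t.1 (t.2 l).

Lemma mean_row_law (F : row -> R) :
  \sum_t row_law t * F t =
  \sum_x p1 x * \sum_(v : {ffun 'I_L -> U}) \prod_l aux_kernel x (v l) * F (x, v).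
Proof.
under [RHS]eq_bigr do rewrite mulr_sumr.
by rewrite pair_bigA; apply: eq_bigr => -[x v] _; rewrite mulrA.
Qed.

Lemma row_law_pmf : is_pmf row_law.
Proof.
split=> [t|].
  rewrite mulr_ge0 ?hp1.1 // prodr_ge0 // => l _; exact: (aux_kernel_pmf _).1.
transitivity (\sum_t row_law t * 1).
  by apply: eq_bigr => t _; rewrite mulr1.
rewrite mean_row_law -[RHS]hp1.2; apply: eq_bigr => x _.
rewrite -mulr_suml (sum_prod_pmf _ (aux_kernel_pmf x)) //.
by rewrite !mulr1.
Qed.

(** [T2] is the relay's test for messages, [D] the small-density test for covering, [T3] the
    receiver's test, and [s] the tolerated failure probability of [T3]. *)
Variables (T2 : X1 -> Y2 -> bool) (D : X1 -> U -> Y2 -> bool).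
Variables (T3 : X1 -> U -> Y3 -> bool) (s : R).

Definition miss3 x u y := \sum_z W3 x (f u x y) y z * (~~ T3 x u z)%:R.
(** The bound on [miss3] stands in for a Markov lemma: whichever coverable word the relay picks, the
    receiver rejects it with probability at most [s], although the pick depends on the whole row. *)
Definition coverable x u y := D x u y && (miss3 x u y <= s).
Definition cover_index (t : row) y : 'I_L :=
  odflt l0 [pick l | coverable t.1 (t.2 l) y].
Definition genie_input (t : row) y : X2 := f (t.2 (cover_index t y)) t.1 y.
Definition relay_guess (c : codebook) y : 'I_M :=
  odflt m0 [pick m | T2 (c m).1 y].
Definition relay_input (c : codebook) y : X2 :=
  genie_input (c (relay_guess c y)) y.
Definition decoder (c : codebook) z : option 'I_M :=
  [pick m | [exists l, T3 (c m).1 ((c m).2 l) z]].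

Definition msg_error (c : codebook) m : R :=
  \sum_y W2 (c m).1 y * \sum_z W3 (c m).1 (relay_input c y) y z *
    (decoder c z != Some m)%:R.

Definition own_error (t : row) : R :=
  \sum_y W2 t.1 y * ((~~ T2 t.1 y)%:R + s +
    [forall l, ~~ coverable t.1 (t.2 l) y]%:R).

(** Union bound over the ways a wrong row [t'] can do harm, at the relay or at the receiver. Only
    two rows occur, so pairwise independence suffices to average it. *)
Definition confusion (t t' : row) : R :=
  \sum_y W2 t.1 y * ((T2 t'.1 y)%:R +
    \sum_z W3 t.1 (genie_input t y) y z * \sum_l (T3 t'.1 (t'.2 l) z)%:R).

Lemma relay_guess_correct (c : codebook) m y : T2 (c m).1 y ->
  (forall m', m' != m -> ~~ T2 (c m').1 y) -> relay_guess c y = m.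
Proof.
move=> Tm Tn; rewrite /relay_guess; case: pickP => [m' Tm' | /(_ m)] /=.
  by apply/eqP; apply: contraLR Tm'; exact: Tn.
by rewrite Tm.
Qed.

(** Union bound: the decoder errs only if the word [l] of the true message is rejected or some word
    of a wrong message is accepted. It will be used with [l] the index chosen by the genie-aided
    relay. *)
Lemma decoder_error_le (c : codebook) m l z : (decoder c z != Some m)%:R <=
  (~~ T3 (c m).1 ((c m).2 l) z)%:R +
  \sum_(m' | m' != m) \sum_l' (T3 (c m').1 ((c m').2 l') z)%:R :> R.
Proof.
have S0 m' : 0 <= \sum_l' (T3 (c m').1 ((c m').2 l') z)%:R :> R.
  by apply: sumr_ge0.
have [T|_] := boolP (T3 _ _ _); last first.
  apply: le_trans (_ : 1 <= _); first by case: (_ != _).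
  by rewrite lerDl sumr_ge0.
rewrite add0r /decoder; case: pickP => [m' /existsP[l' T'] | /(_ m)]; last first.
  by move/negbT/existsPn/(_ l); rewrite T.
have [->|m'm] := eqVneq m' m; first by rewrite eqxx sumr_ge0.
rewrite (bigD1 m') //= (bigD1 l') //= T'.
apply: le_trans (_ : 1 <= _); first by case: (_ != _).
by rewrite -addrA lerDl addr_ge0 ?sumr_ge0.
Qed.

(** If no index qualifies, the choice falls on the arbitrary [l0], and the indicator pays for the
    trivial bound 1. *)
Lemma miss3_cover_index (t : row) y : 0 <= s ->
  miss3 t.1 (t.2 (cover_index t y)) y <=
  s + [forall l, ~~ coverable t.1 (t.2 l) y]%:R.
Proof.
move=> s0; rewrite /cover_index; case: pickP => [l /andP[_ h] /= | h].
  by apply: (le_trans h); rewrite lerDl.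
have -> : [forall l, ~~ coverable t.1 (t.2 l) y].
  by apply/forallP => l; rewrite h.
apply: le_trans (_ : 1 <= _); last by rewrite lerDr.
apply: mean_le_cst; first exact: hW.2.
by move=> z; case: (~~ _).
Qed.

(* When the relay's guess is right, the relay acts as the genie-aided one, whose
   output does not depend on the rows of the other messages. *)
Lemma msg_error_le (c : codebook) m : 0 <= s ->
  msg_error c m <= own_error (c m) + \sum_(m' | m' != m) confusion (c m) (c m').
Proof.
move=> s0; rewrite /msg_error /own_error /confusion exchange_big -big_split /=.
apply: ler_sum => y _; rewrite -mulr_sumr -mulrDr.
apply: ler_wpM2l; first exact: (hW.1 _).1.
have W30 x x2 z : 0 <= W3 x x2 y z by exact: (hW.2 _ _ _).1.
have conf0 m' : 0 <= \sum_z W3 (c m).1 (genie_input (c m) y) y z *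
   \sum_l (T3 (c m').1 ((c m').2 l) z)%:R.
  by apply: mean_ge0 => // z; apply: sumr_ge0.
have [good|] := boolP (T2 (c m).1 y && [forall (m' | m' != m), ~~ T2 (c m').1 y]).
  case/andP: good => Tm /forall_inP Tn.
  rewrite /relay_input (relay_guess_correct Tm Tn) -/(genie_input _ _).
  set t := c m; set l := cover_index t y.
  have : \sum_z W3 t.1 (genie_input t y) y z * (decoder c z != Some m)%:R <=
     miss3 t.1 (t.2 l) y + \sum_(m' | m' != m)
     \sum_z W3 t.1 (genie_input t y) y z * \sum_l (T3 (c m').1 ((c m').2 l) z)%:R.
    rewrite exchange_big -big_split /=; apply: ler_sum => z _.
    rewrite -mulr_sumr -mulrDr ler_wpM2l //; exact: decoder_error_le.
  move/le_trans; apply; rewrite Tm add0r; apply: lerD.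
    exact: miss3_cover_index.
  by apply: ler_sum => m' m'm; rewrite lerDr.
(* If the relay may guess wrongly, the error is bounded by 1, which is paid by the indicator of the
   failing test: that of the true codeword in [own_error], or that of a wrong one in [confusion]. *)
move=> bad; apply: le_trans (_ : 1 <= _).
  apply: mean_le_cst; first exact: hW.2.
  by move=> z; case: (_ != _).
have F0 : 0 <= [forall l, ~~ coverable (c m).1 ((c m).2 l) y]%:R :> R by [].
move: bad; rewrite negb_and negb_forall => /orP[-> | /existsP[m']].
  by rewrite -!addrA lerDl !addr_ge0 // sumr_ge0 // => m' _; rewrite addr_ge0.
rewrite negb_imply negbK => /andP[m'm T].
rewrite (bigD1 m') //= T addrCA -addrA lerDl !addr_ge0 //.
by apply: sumr_ge0 => i _; rewrite addr_ge0.
Qed.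

Variables (tau eps2 eps3 d2 dD d3 : R).
Hypotheses (s_gt0 : 0 < s) (tau_gt0 : 0 < tau).
Hypotheses (eps2_ge0 : 0 <= eps2) (eps3_ge0 : 0 <= eps3).
Hypothesis hD : forall x u y, D x u y -> q x y u <= tau * aux_kernel x u.
Hypothesis heps2 : forall y, \sum_x p1 x * (T2 x y)%:R <= eps2.
Hypothesis heps3 : forall z,
  \sum_x p1 x * \sum_u aux_kernel x u * (T3 x u z)%:R <= eps3.
Hypothesis hd2 : \sum_x p1 x * \sum_y W2 x y * (~~ T2 x y)%:R <= d2.
Hypothesis hdD :
  \sum_x p1 x * \sum_y W2 x y * \sum_u q x y u * (~~ D x u y)%:R <= dD.
Hypothesis hd3 :
  \sum_x p1 x * \sum_y W2 x y * \sum_u q x y u * miss3 x u y <= d3.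

Lemma expected_confusion t : \sum_t' row_law t' * confusion t t' <=
  eps2 + L%:R * eps3.
Proof.
(* The genie-aided input depends on [t] only, so the average over [t'] moves inside, down to fixed
   [y] and [z], where [heps2] and [heps3] apply. *)
have -> : \sum_t' row_law t' * confusion t t' =
   \sum_y W2 t.1 y * (\sum_t' row_law t' * (T2 t'.1 y)%:R +
     \sum_z W3 t.1 (genie_input t y) y z *
       \sum_l \sum_t' row_law t' * (T3 t'.1 (t'.2 l) z)%:R).
  rewrite /confusion; under eq_bigr do rewrite mulr_sumr.
  rewrite exchange_big; apply: eq_bigr => y _ /=.
  under [X in _ = _ * (_ + X)]eq_bigr => z _ do rewrite exchange_big mulr_sumr /=.
  rewrite exchange_big -big_split mulr_sumr /=; apply: eq_bigr => t' _.
  rewrite mulrCA mulrDr; congr (_ * (_ + _)); rewrite mulr_sumr.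
  apply: eq_bigr => z _; rewrite mulrCA; congr (_ * _).
  by rewrite mulr_sumr.
apply: mean_le_cst; first exact: hW.1.
move=> y; apply: lerD.
  rewrite mean_row_law; apply: le_trans (heps2 y).
  rewrite le_eqVlt; apply/orP; left; apply/eqP; apply: eq_bigr => x _.
  by rewrite /= -mulr_suml (sum_prod_pmf _ (aux_kernel_pmf x)) mul1r.
apply: mean_le_cst; first exact: hW.2.
move=> z; apply: le_trans (_ : \sum_(l < L) eps3 <= _); last first.
  by rewrite sumr_const card_ord mulr_natl.
apply: ler_sum => l _; rewrite mean_row_law; apply: le_trans (heps3 z).
rewrite le_eqVlt; apply/orP; left; apply/eqP; apply: eq_bigr => x _.
congr (_ * _).
exact: (sum_prod_marginal (aux_kernel_pmf x) l (fun u => (T3 x u z)%:R)).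
Qed.

(* Markov's inequality in disguise: [miss3] is a conditional probability. *)
Lemma uncoverable_le x u y :
  (~~ coverable x u y)%:R <= (~~ D x u y)%:R + miss3 x u y / s :> R.
Proof.
have m0' : 0 <= miss3 x u y.
  by apply: mean_ge0 => z //; exact: (hW.2 _ _ _).1.
rewrite /coverable negb_and; have [_|_] := boolP (D x u y) => /=; last first.
  by rewrite lerDl divr_ge0 // ltW.
rewrite add0r -ltNge; case: ltP => h /=; last by rewrite divr_ge0 // ltW.
by rewrite ler_pdivlMr // mul1r ltW.
Qed.

(** Given [x], the words are i.i.d. and all fail with probability [(1 - g) ^+ L], where [g] is the
    mass of coverable words under [aux_kernel]. On [D] the true law [q] is at most [tau] times
    [aux_kernel], so the true mass [a] is at most [tau * g], and [miss_prob_le] applies. *)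
Lemma no_cover_le x y :
  \sum_(v : {ffun 'I_L -> U}) \prod_l aux_kernel x (v l) *
    [forall l, ~~ coverable x (v l) y]%:R <=
  \sum_u q x y u * (~~ coverable x u y)%:R + tau / L%:R.
Proof.
have [k0 k1] := aux_kernel_pmf x; have [q0 q1] := hq x y.
set a := \sum_u q x y u * (coverable x u y)%:R.
set g := \sum_u aux_kernel x u * (coverable x u y)%:R.
have compl (p : U -> R) : \sum_u p u = 1 ->
    \sum_u p u * (~~ coverable x u y)%:R =
    1 - \sum_u p u * (coverable x u y)%:R.
  move=> ps; rewrite -[X in X - _]ps -sumrB; apply: eq_bigr => u _.
  by case: coverable; rewrite /= ?mulr1 ?mulr0 ?subrr ?subr0.
have -> : \sum_(v : {ffun 'I_L -> U}) \prod_l aux_kernel x (v l) *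
    [forall l, ~~ coverable x (v l) y]%:R = (1 - g) ^+ L.
  transitivity (\sum_(v : {ffun 'I_L -> U}) \prod_l aux_kernel x (v l) *
    \prod_l (~~ coverable x (v l) y)%:R).
    apply: eq_bigr => v _; congr (_ * _).
    case: forallP => [h | /forallP/forallPn[l /negbTE h]].
      by rewrite big1 // => l _; rewrite h.
    by rewrite (bigD1 l) //= h mul0r.
  rewrite (sum_prod_weights _ (fun _ u => (~~ coverable x u y)%:R)).
  by rewrite prodr_const card_ord compl.
rewrite (compl _ q1) -/a; apply: miss_prob_le => //.
- by case: L l0 => [[]|].
- rewrite /a mean_ge0 //=; apply: mean_le_cst => // u.
  by case: coverable.
- rewrite /a /g mulr_sumr; apply: ler_sum => u _.
  have [/andP[/hD h _]|_] := boolP (coverable x u y); first by rewrite !mulr1.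
  by rewrite !mulr0.
- by apply: mean_le_cst => // u; case: coverable.
Qed.

Lemma expected_own_error : \sum_t row_law t * own_error t <=
  d2 + s + dD + d3 / s + tau / L%:R.
Proof.
rewrite mean_row_law.
(* For fixed [x] only the covering term involves the words [v]; the other terms integrate out. *)
have step x : \sum_(v : {ffun 'I_L -> U}) \prod_l aux_kernel x (v l) *
    own_error (x, v) <=
  \sum_y W2 x y * ((~~ T2 x y)%:R + s +
    (\sum_u q x y u * ((~~ D x u y)%:R + miss3 x u y / s) + tau / L%:R)).
  have -> : \sum_(v : {ffun 'I_L -> U}) \prod_l aux_kernel x (v l) *
    own_error (x, v) = \sum_y W2 x y * ((~~ T2 x y)%:R + s +
     \sum_(v : {ffun 'I_L -> U}) \prod_l aux_kernel x (v l) *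
       [forall l, ~~ coverable x (v l) y]%:R).
    rewrite /own_error /=; under eq_bigr do rewrite mulr_sumr.
    rewrite exchange_big; apply: eq_bigr => y _ /=.
    under eq_bigr do rewrite mulrCA mulrDr.
    rewrite -mulr_sumr big_split /= -mulr_suml.
    by rewrite (sum_prod_pmf _ (aux_kernel_pmf x)) mul1r.
  apply: mean_le => y; first exact: (hW.1 x).1.
  rewrite lerD2l (le_trans (no_cover_le x y)) // lerD2r.
  apply: mean_le => u; [exact: (hq _ _).1|exact: uncoverable_le].
apply: (le_trans (mean_le hp1.1 step)).
have cst (c : R) : \sum_x p1 x * \sum_y W2 x y * c = c.
  under eq_bigr do rewrite -mulr_suml (hW.1 _).2 mul1r.
  by rewrite -mulr_suml hp1.2 mul1r.
have -> : \sum_x p1 x * \sum_y W2 x y * ((~~ T2 x y)%:R + s +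
    (\sum_u q x y u * ((~~ D x u y)%:R + miss3 x u y / s) + tau / L%:R)) =
  \sum_x p1 x * \sum_y W2 x y * (~~ T2 x y)%:R + s +
  \sum_x p1 x * \sum_y W2 x y * \sum_u q x y u * (~~ D x u y)%:R +
  (\sum_x p1 x * \sum_y W2 x y * \sum_u q x y u * miss3 x u y) / s +
  tau / L%:R.
  rewrite -[X in _ + X + _ + _ + _](cst s) -[X in _ + X](cst (tau / L%:R)).
  rewrite mulr_suml -!big_split /=; apply: eq_bigr => x _.
  rewrite -mulrA -!mulrDr; congr (_ * _).
  rewrite mulr_suml -!big_split /=; apply: eq_bigr => y _.
  rewrite -mulrA -!mulrDr; congr (_ * _).
  under eq_bigr do rewrite mulrDr mulrA.
  by rewrite big_split -mulr_suml /= !addrA.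
rewrite lerD2r !lerD // ler_pM2r ?invr_gt0 //.
Qed.

(** With i.i.d. rows, [own_error] is averaged over one row and [confusion] over two independent
    ones; a codebook no worse than the mean is then fixed. *)
Lemma one_shot_code : exists c : codebook,
  (M%:R)^-1 * \sum_m msg_error c m <=
  d2 + s + dD + d3 / s + tau / L%:R + M%:R * (eps2 + L%:R * eps3).
Proof.
have M0 : 0 < M%:R :> R by rewrite ltr0n; case: M m0 => [[]|].
have e0 : 0 <= eps2 + L%:R * eps3.
  by rewrite addr_ge0 // mulr_ge0.
have hc : is_pmf (fun c : codebook => \prod_m row_law (c m)).
  split=> [c|]; last exact: (sum_prod_pmf _ row_law_pmf).
  by apply: prodr_ge0 => m _; exact: row_law_pmf.1.
apply: (exists_le_mean hc).
set EA := d2 + _ + _ + _ + _; set EB := eps2 + _.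
have msg m : \sum_(c : codebook) \prod_m row_law (c m) * msg_error c m
   <= EA + M%:R * EB.
  apply: (le_trans (mean_le hc.1 (fun c => msg_error_le c m (ltW s_gt0)))).
  under eq_bigr do rewrite mulrDr.
  rewrite big_split /= (sum_prod_marginal row_law_pmf m own_error).
  apply: lerD; first exact: expected_own_error.
  under eq_bigr do rewrite mulr_sumr.
  rewrite exchange_big /=.
  (* Each wrong message costs at most [EB] on average, and their number is bounded by [M]. *)
  apply: le_trans (_ : \sum_(m' | m' != m) EB <= _).
    apply: ler_sum => m' m'm.
    rewrite (sum_prod_marginal2 row_law_pmf confusion m'm).
    apply: mean_le_cst => [|t]; first exact: row_law_pmf.
    exact: expected_confusion.
  rewrite sumr_const mulr_natl ler_wpMn2l //.
  by rewrite -[leqRHS](card_ord M) max_card.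
under eq_bigr do rewrite mulrCA mulr_sumr.
rewrite -mulr_sumr exchange_big /= ler_pdivrMl //.
apply: le_trans (_ : \sum_(m < M) (EA + M%:R * EB) <= _).
  by apply: ler_sum => m _; exact: msg.
by rewrite sumr_const card_ord -[leLHS]mulr_natl.
Qed.

End OneShot.

(** * Chebyshev's inequality for products of i.i.d. ratios *)

Lemma mean_cst (R : realType) (T : finType) (p : T -> R) (a : R) :
  is_pmf p -> \sum_t p t * a = a.
Proof. by move=> hp; rewrite -mulr_suml hp.2 mul1r. Qed.

Lemma prod_pmf (R : realType) (I T : finType) (p : I -> T -> R) :
  (forall i, is_pmf (p i)) ->
  is_pmf (fun c : {ffun I -> T} => \prod_i p i (c i)).
Proof.
move=> hp; split=> [c|]; first by apply: prodr_ge0 => i _; exact: (hp i).1.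
by rewrite -(bigA_distr_bigA p) big1 // => i _; exact: (hp i).2.
Qed.

Section Concentration.
Variables (R : realType) (T : finType) (P : T -> R).
Hypothesis hP : is_pmf P.

(** The cross terms vanish by independence and centring. *)
Lemma second_moment (n : nat) (h : T -> R) : \sum_t P t * h t = 0 ->
  \sum_(t : {ffun 'I_n -> T}) \prod_i P (t i) * (\sum_i h (t i)) ^+ 2 =
  n%:R * \sum_t P t * h t ^+ 2.
Proof.
move=> h0.
transitivity (\sum_(i < n) \sum_(j < n) \sum_(t : {ffun 'I_n -> T})
   \prod_k P (t k) * (h (t i) * h (t j))).
  under [RHS]eq_bigr => i _ do rewrite exchange_big /=.
  rewrite [RHS]exchange_big /=; apply: eq_bigr => t _.
  rewrite expr2 mulr_sumr mulr_sumr; apply: eq_bigr => i _.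
  by rewrite mulr_suml mulr_sumr; apply: eq_bigr => j _; ring.
transitivity (\sum_(i < n) \sum_t P t * h t ^+ 2); last first.
  by rewrite sumr_const card_ord mulr_natl.
apply: eq_bigr => i _; rewrite (bigD1 i) //= [X in _ + X]big1 ?addr0.
  rewrite -(sum_prod_marginal hP i (fun t => h t ^+ 2)).
  by apply: eq_bigr => t _; rewrite expr2.
move=> j ji; rewrite (sum_prod_marginal2 hP (fun a b => h a * h b) ji).
rewrite big1 // => a _; under eq_bigr do rewrite mulrCA.
by rewrite -mulr_sumr h0 !mulr0.
Qed.

Definition pmf_mean (g : T -> R) := \sum_t P t * g t.
Definition pmf_variance (g : T -> R) := \sum_t P t * (g t - pmf_mean g) ^+ 2.

Lemma pmf_variance_ge0 g : 0 <= pmf_variance g.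
Proof. by apply: mean_ge0 => [|t]; [exact: hP.1|exact: sqr_ge0]. Qed.

(** Markov's inequality for the squared centred sum. The event is constrained only where all letters
    have positive mass: other blocks have weight 0, and logarithms of ratios are meaningful only
    there. *)
Lemma chebyshev_prod (n : nat) (g : T -> R) (eta : R)
    (F : {ffun 'I_n -> T} -> bool) : (0 < n)%N -> 0 < eta ->
  (forall t : {ffun 'I_n -> T}, (forall i, 0 < P (t i)) -> F t ->
     n%:R * eta <= `|\sum_i (g (t i) - pmf_mean g)|) ->
  \sum_(t : {ffun 'I_n -> T}) \prod_i P (t i) * (F t)%:R <=
  pmf_variance g / (n%:R * eta ^+ 2).
Proof.
move=> n0 e0 hF; have N0 : 0 < n%:R :> R by rewrite ltr0n.
have h0 : \sum_t P t * (g t - pmf_mean g) = 0.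
  under eq_bigr do rewrite mulrBr.
  by rewrite sumrB (mean_cst _ hP) subrr.
have := @second_moment n _ h0; rewrite -/(pmf_variance g) => m2.
have -> : pmf_variance g / (n%:R * eta ^+ 2) =
   (n%:R * pmf_variance g) / (n%:R * eta) ^+ 2.
  by field; rewrite !gt_eqF.
rewrite -m2 mulr_suml; apply: ler_sum => t _.
have [Pt|] := boolP [forall i, 0 < P (t i)]; last first.
  move=> /forallPn[i]; rewrite -leNgt => Pi.
  have {}Pi : P (t i) = 0 by apply/eqP; rewrite eq_le Pi hP.1.
  by rewrite (bigD1 i) //= Pi !mul0r.
rewrite -mulrA ler_wpM2l //; first by apply: prodr_ge0 => i _; exact: hP.1.
have [Ft|_] := boolP (F t); last by rewrite divr_ge0 // sqr_ge0.
rewrite ler_pdivlMr ?exprn_gt0 ?mulr_gt0 // mul1r.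
rewrite -[leRHS]real_normK ?num_real //.
rewrite ler_pXn2r ?nnegrE ?mulr_ge0 ?(ltW e0) //.
by apply: hF => //; exact/forallP.
Qed.

Lemma powR_sum (I : finType) (h : I -> R) :
  \prod_i 2 `^ (h i) = 2 `^ (\sum_i h i).
Proof.
elim/big_rec2: _ => [|i y x _ ->]; first by rewrite powRr0.
by rewrite powRD // pnatr_eq0 implybT.
Qed.

Lemma ln2_gt0 : 0 < ln 2 :> R.
Proof. by rewrite ln_gt0 // ltr1n. Qed.

Lemma powR_log2 (x : R) : 0 < x -> 2 `^ (log2 x) = x.
Proof.
move=> x0; rewrite /powR pnatr_eq0 /= /log2 divfK ?lnK //.
by rewrite gt_eqF // ln2_gt0.
Qed.

Lemma ler_pow2 (x y : R) : (2 `^ x <= 2 `^ y) = (x <= y).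
Proof.
by rewrite /powR pnatr_eq0 /= ler_expR ler_pM2r // ln2_gt0.
Qed.

Variable r : T -> R.
Hypothesis r_gt0 : forall t, 0 < P t -> 0 < r t.
Let mu := pmf_mean (fun t => log2 (r t)).

(** A threshold on the product of ratios thereby becomes a threshold on a centred sum of
    logarithms. *)
Lemma prod_ratio n (t : {ffun 'I_n -> T}) : (forall i, 0 < P (t i)) ->
  \prod_i r (t i) = 2 `^ (\sum_i (log2 (r (t i)) - mu) + n%:R * mu).
Proof.
move=> Pt; rewrite sumrB sumr_const card_ord mulr_natl subrK -powR_sum.
apply: eq_bigr => i _.
by rewrite powR_log2 // r_gt0.
Qed.

Lemma ratio_lower_tail (n : nat) (eta : R) (F : {ffun 'I_n -> T} -> bool) :
  (0 < n)%N -> 0 < eta ->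
  (forall t : {ffun 'I_n -> T}, (forall i, 0 < P (t i)) -> F t ->
     \prod_i r (t i) <= 2 `^ (n%:R * (mu - eta))) ->
  \sum_(t : {ffun 'I_n -> T}) \prod_i P (t i) * (F t)%:R <=
  pmf_variance (fun t => log2 (r t)) / (n%:R * eta ^+ 2).
Proof.
move=> n0 e0 hF; apply: chebyshev_prod => // t Pt Ft.
move: (hF t Pt Ft); rewrite prod_ratio // ler_pow2 -/mu.
set S := \sum_i _ => h; rewrite -normrN; apply: le_trans (ler_norm _).
by move: h; rewrite mulrBr; lra.
Qed.

Lemma ratio_upper_tail (n : nat) (eta : R) (F : {ffun 'I_n -> T} -> bool) :
  (0 < n)%N -> 0 < eta ->
  (forall t : {ffun 'I_n -> T}, (forall i, 0 < P (t i)) -> F t ->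
     2 `^ (n%:R * (mu + eta)) <= \prod_i r (t i)) ->
  \sum_(t : {ffun 'I_n -> T}) \prod_i P (t i) * (F t)%:R <=
  pmf_variance (fun t => log2 (r t)) / (n%:R * eta ^+ 2).
Proof.
move=> n0 e0 hF; apply: chebyshev_prod => // t Pt Ft.
move: (hF t Pt Ft); rewrite prod_ratio // ler_pow2 -/mu.
set S := \sum_i _ => h; apply: le_trans (ler_norm _).
by move: h; rewrite mulrDr; lra.
Qed.

End Concentration.

(** * Marginals of blocks and information densities *)

Lemma sum_ffun_pair (R : realType) (I A B : finType)
    (F : {ffun I -> A} -> {ffun I -> B} -> R) :
  \sum_a \sum_b F a b =
  \sum_(s : {ffun I -> A * B}) F [ffun i => (s i).1] [ffun i => (s i).2].
Proof.
rewrite pair_bigA /=.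
rewrite (reindex (fun s : {ffun I -> A * B} =>
  ([ffun i => (s i).1], [ffun i => (s i).2]))) //=.
exists (fun p : {ffun I -> A} * {ffun I -> B} => [ffun i => (p.1 i, p.2 i)]) => [s _|[a b] _].
  by apply/ffunP => i; rewrite !ffunE -surjective_pairing.
by congr (_, _); apply/ffunP => i; rewrite !ffunE.
Qed.

(** Blocks are grouped by their image under [phi]; the fibre over [s] is the product of the fibres
    over its letters. *)
Lemma sum_prod_marg (R : realType) (I T A : finType) (P : T -> R) (phi : T -> A)
    (F : {ffun I -> A} -> R) :
  \sum_(s : {ffun I -> A}) \prod_i marg P phi (s i) * F s =
  \sum_(t : {ffun I -> T}) \prod_i P (t i) * F [ffun i => phi (t i)].
Proof.
rewrite [RHS](partition_big (fun t : {ffun I -> T} => [ffun i => phi (t i)])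
  xpredT) //=.
apply: eq_bigr => s _; rewrite /marg bigA_distr_big_dep mulr_suml.
rewrite [RHS](eq_bigr (fun t : {ffun I -> T} => \prod_i P (t i) * F s)).
  apply: eq_bigl => t; apply/familyP/eqP => [h|<- i].
    by apply/ffunP => i; rewrite ffunE; apply/eqP; exact: h.
  by rewrite ffunE; exact: eqxx.
by move=> t /eqP ->.
Qed.

Lemma marg_ge0 (R : realType) (T A : finType) (P : T -> R) (phi : T -> A) a :
  is_pmf P -> 0 <= marg P phi a.
Proof. by move=> hP; apply: sumr_ge0 => t _; exact: hP.1. Qed.

Lemma marg_gt0 (R : realType) (T A : finType) (P : T -> R) (phi : T -> A) t :
  is_pmf P -> 0 < P t -> 0 < marg P phi (phi t).
Proof.
move=> hP Pt; rewrite /marg (bigD1 t) //= ltr_wpDr //.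
by apply: sumr_ge0 => s _; exact: hP.1.
Qed.

Lemma margE (R : realType) (T A : finType) (P : T -> R) (phi : T -> A) a :
  marg P phi a = \sum_t P t * (phi t == a)%:R.
Proof.
rewrite /marg big_mkcond; apply: eq_bigr => t _.
by case: (_ == _); rewrite ?mulr1 ?mulr0.
Qed.

Section Density.
Variables (R : realType) (T A B C : finType) (P : T -> R).
Variables (fa : T -> A) (fb : T -> B) (fc : T -> C).
Hypothesis hP : is_pmf P.

(** The argument of the logarithm in [cmi]: the information density before taking logarithms. A
    constant [fc] gives the unconditional one. *)
Definition density a b c :=
  marg P (fun s => (fa s, fb s, fc s)) (a, b, c) * marg P fc c
     / (marg P (fun s => (fa s, fc s)) (a, c)
        * marg P (fun s => (fb s, fc s)) (b, c)).

Lemma cmi_density :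
  cmi P fa fb fc = pmf_mean P (fun t => log2 (density (fa t) (fb t) (fc t))).
Proof. by []. Qed.

Lemma density_gt0 t : 0 < P t -> 0 < density (fa t) (fb t) (fc t).
Proof.
move=> Pt; rewrite divr_gt0 // mulr_gt0 //.
- exact: (marg_gt0 (fun s => (fa s, fb s, fc s))).
- exact: marg_gt0.
- exact: (marg_gt0 (fun s => (fa s, fc s))).
- exact: (marg_gt0 (fun s => (fb s, fc s))).
Qed.

Lemma density_ge0 a b c : 0 <= density a b c.
Proof. by rewrite divr_ge0 // mulr_ge0 // marg_ge0. Qed.

End Density.

(** For fixed [b] the terms are the conditional probabilities of [a] given [b]. Their sum is 1,
    except when [b] has mass 0, where division by zero makes it 0. *)
Lemma mean_density_le1 (R : realType) (T A B : finType) (P : T -> R)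
    (fa : T -> A) (fb : T -> B) (hP : is_pmf P) b :
  \sum_a marg P fa a * density P fa fb (fun=> tt) a b tt <= 1.
Proof.
have m1 : marg P (fun=> tt) tt = 1.
  by rewrite /marg -hP.2; apply: eq_bigl => t; rewrite eqxx.
set mb := marg P (fun s => (fb s, tt)) (b, tt).
have mb0 : 0 <= mb by exact: marg_ge0.
apply: le_trans (_ : \sum_a marg P (fun s => (fa s, fb s, tt)) (a, b, tt) / mb <= _).
  apply: ler_sum => a _; rewrite /density m1 mulr1 -/mb.
  have -> : marg P (fun s => (fa s, tt)) (a, tt) = marg P fa a.
    by apply: eq_bigl => t; rewrite xpair_eqE andbT.
  have [->|ma] := eqVneq (marg P fa a) 0.
    by rewrite mul0r divr_ge0 // marg_ge0.
  by rewrite invfM mulrCA mulrA mulrA mulfK // mulrC.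
rewrite -mulr_suml.
have -> : \sum_a marg P (fun s => (fa s, fb s, tt)) (a, b, tt) = mb.
  rewrite /mb {2}/marg (partition_big fa xpredT) //=; apply: eq_bigr => a _.
  by apply: eq_bigl => t; rewrite !xpair_eqE !andbT andbC.
have [->|mb1] := eqVneq mb 0; first by rewrite mul0r ler01.
by rewrite divff.
Qed.

(** Markov's inequality: the indicator is at most the product divided by [theta], and the mean of
    the product factors into numbers at most 1. As [y] is arbitrary, nothing is assumed about its
    law. *)
Lemma threshold_mass_le (R : realType) (n : nat) (A B : finType) (w : A -> R)
    (d : A -> B -> R) (y : {ffun 'I_n -> B}) (theta : R) :
  (forall a, 0 <= w a) -> (forall a b, 0 <= d a b) ->
  (forall b, \sum_a w a * d a b <= 1) -> 0 < theta ->
  \sum_(x : {ffun 'I_n -> A}) \prod_i w (x i) *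
    (theta < \prod_i d (x i) (y i))%R%:R <= theta^-1.
Proof.
move=> w0 d0 wd t0.
apply: le_trans (_ : \sum_(x : {ffun 'I_n -> A}) \prod_i w (x i) *
    ((\prod_i d (x i) (y i)) / theta) <= _).
  apply: ler_sum => x _; rewrite ler_wpM2l ?prodr_ge0 //.
  case: ltP => h /=; last by rewrite divr_ge0 ?prodr_ge0 // ltW.
  by rewrite ler_pdivlMr // mul1r ltW.
under eq_bigr do rewrite mulrA.
rewrite -mulr_suml (sum_prod_weights w (fun i a => d a (y i))).
rewrite ler_piMl ?invr_ge0 ?(ltW t0) //.
apply: Num.Theory.prodr_ile1 => i _; rewrite wd andbT sumr_ge0 // => a _.
exact: mulr_ge0.
Qed.

(** * The single-letter joint law and its marginals *)

Section JointLaw.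
Variables (R : realType) (X1 X2 Y2 Y3 U : finType).
Variables (W2 : X1 -> Y2 -> R) (W3 : X1 -> X2 -> Y2 -> Y3 -> R).
Hypothesis hW : relay_channel W2 W3.
Variables (p1 : X1 -> R) (q : X1 -> Y2 -> U -> R) (f : U -> X1 -> Y2 -> X2).
Hypotheses (hp1 : is_pmf p1) (hq : forall x y, is_pmf (q x y)).

Notation space := (X1 * U * Y2 * X2 * Y3)%type.

Definition joint (t : space) : R := let: (x1, u, y2, x2, y3) := t in
  p1 x1 * W2 x1 y2 * q x1 y2 u * (if x2 == f u x1 y2 then 1 else 0)
  * W3 x1 x2 y2 y3.

(** The indicator collapses the sum over [x2], leaving the nested averages in which the one-shot
    bound is expressed. *)
Lemma sum_joint (F : space -> R) : \sum_t joint t * F t =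
  \sum_x p1 x * \sum_y W2 x y * \sum_u q x y u *
    \sum_z W3 x (f u x y) y z * F (x, u, y, f u x y, z).
Proof.
transitivity (\sum_x \sum_u \sum_y \sum_x2 \sum_z
  joint (x, u, y, x2, z) * F (x, u, y, x2, z)).
  by rewrite !pair_bigA /=; apply: eq_bigr => -[[[[x u] y] x2] z] _.
apply: eq_bigr => x _; rewrite exchange_big mulr_sumr; apply: eq_bigr => y _.
rewrite mulrA mulr_sumr; apply: eq_bigr => u _.
rewrite (bigD1 (f u x y)) //= [X in _ + X]big1 ?addr0.
  by rewrite mulrA mulr_sumr; apply: eq_bigr => z _; rewrite eqxx; ring.
move=> x2 /negbTE x2f; rewrite big1 // => z _.
by rewrite x2f mulr0 !mul0r.
Qed.

Lemma joint_ge0 t : 0 <= joint t.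
Proof.
case: t => [[[[x u] y] x2] z]; rewrite /joint !mulr_ge0 //.
- exact: hp1.1.
- exact: (hW.1 x).1.
- exact: (hq x y).1.
- by case: ifP.
- exact: (hW.2 _ _ _).1.
Qed.

Lemma joint_pmf : is_pmf joint.
Proof.
split; first exact: joint_ge0.
transitivity (\sum_t joint t * 1); first by apply: eq_bigr => t _; rewrite mulr1.
rewrite sum_joint -[RHS](mean_cst _ hp1); apply: eq_bigr => x _.
congr (_ * _); rewrite -[RHS](mean_cst _ (hW.1 x)); apply: eq_bigr => y _.
congr (_ * _); rewrite -[RHS](mean_cst _ (hq x y)); apply: eq_bigr => u _.
by congr (_ * _); apply: mean_cst; exact: hW.2.
Qed.

Lemma pair_eq_natr (A B : eqType) (a a' : A) (b b' : B) :
  ((a, b) == (a', b'))%:R = (a == a')%:R * (b == b')%:R :> R.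
Proof. by rewrite xpair_eqE -natrM mulnb. Qed.

Lemma marg_all x y u z :
  marg joint (fun t => (t.1.1.1.1, t.1.1.2, t.1.1.1.2, t.2)) (x, y, u, z) =
  p1 x * W2 x y * q x y u * W3 x (f u x y) y z.
Proof.
rewrite margE sum_joint /=.
transitivity (\sum_x' (p1 x' * W2 x' y * q x' y u * W3 x' (f u x' y) y z) *
  (x' == x)%:R); last by rewrite sum_delta_r.
apply: eq_bigr => x' _; rewrite -!mulrA; congr (_ * _).
(* The indicators of the fixed values are reinserted one variable at a time, until both sides agree
   term by term. *)
rewrite -[RHS](sum_delta_r (fun y' => W2 x' y' * (q x' y' u *
  (W3 x' (f u x' y') y' z * (x' == x)%:R)))).
apply: eq_bigr => y' _; rewrite -!mulrA; congr (_ * _).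
rewrite -[RHS](sum_delta_r (fun u' => q x' y' u' *
  (W3 x' (f u' x' y') y' z * ((x' == x)%:R * (y' == y)%:R)))).
apply: eq_bigr => u' _; rewrite -!mulrA; congr (_ * _).
rewrite -[RHS](sum_delta_r (fun z' => W3 x' (f u' x' y') y' z' *
  ((x' == x)%:R * ((y' == y)%:R * (u' == u)%:R)))).
by apply: eq_bigr => z' _; rewrite !pair_eq_natr; ring.
Qed.

Lemma marg_X1 x : marg joint (fun t => t.1.1.1.1) x = p1 x.
Proof.
rewrite margE sum_joint /= -[RHS]sum_delta_r; apply: eq_bigr => x' _.
congr (_ * _); rewrite -[RHS](mean_cst _ (hW.1 x')); apply: eq_bigr => y _.
congr (_ * _); rewrite -[RHS](mean_cst _ (hq x' y)); apply: eq_bigr => u _.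
by congr (_ * _); rewrite mean_cst //; exact: hW.2.
Qed.

Lemma marg_X1U x u :
  marg joint (fun t => (t.1.1.1.1, t.1.1.1.2)) (x, u) = p1 x * aux_kernel W2 q x u.
Proof.
rewrite margE sum_joint /=.
rewrite -[RHS](sum_delta_r (fun x' => p1 x' * aux_kernel W2 q x' u)).
apply: eq_bigr => x' _; rewrite -mulrA; congr (_ * _).
rewrite /aux_kernel mulr_suml; apply: eq_bigr => y _.
rewrite -mulrA; congr (_ * _).
rewrite -[RHS](sum_delta_r (fun u' => q x' y u' * (x' == x)%:R)).
apply: eq_bigr => u' _; rewrite -mulrA; congr (_ * _).
by rewrite mean_cst ?pair_eq_natr //; exact: hW.2.
Qed.

Lemma marg_UX1 u x :
  marg joint (fun t => (t.1.1.1.2, t.1.1.1.1)) (u, x) = p1 x * aux_kernel W2 q x u.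
Proof.
by rewrite -marg_X1U; apply: eq_bigl => t; rewrite !xpair_eqE andbC.
Qed.

Lemma marg_Y2X1 y x :
  marg joint (fun t => (t.1.1.2, t.1.1.1.1)) (y, x) = p1 x * W2 x y.
Proof.
rewrite margE sum_joint /= -[RHS](sum_delta_r (fun x' => p1 x' * W2 x' y)).
apply: eq_bigr => x' _; rewrite -mulrA; congr (_ * _).
rewrite -[RHS](sum_delta_r (fun y' => W2 x' y' * (x' == x)%:R)).
apply: eq_bigr => y' _; rewrite -mulrA; congr (_ * _).
rewrite -[RHS](mean_cst _ (hq x' y')); apply: eq_bigr => u' _.
congr (_ * _); rewrite mean_cst; last exact: hW.2.
by rewrite pair_eq_natr mulrC.
Qed.

Lemma marg_UY2X1 u y x :
  marg joint (fun t => (t.1.1.1.2, t.1.1.2, t.1.1.1.1)) (u, y, x) =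
  p1 x * W2 x y * q x y u.
Proof.
rewrite margE sum_joint /=.
rewrite -[RHS](sum_delta_r (fun x' => p1 x' * W2 x' y * q x' y u)).
apply: eq_bigr => x' _; rewrite -!mulrA; congr (_ * _).
rewrite -[RHS](sum_delta_r (fun y' => W2 x' y' * (q x' y' u * (x' == x)%:R))).
apply: eq_bigr => y' _; rewrite -!mulrA; congr (_ * _).
rewrite -[RHS](sum_delta_r (fun u' => q x' y' u' *
  ((x' == x)%:R * (y' == y)%:R))).
apply: eq_bigr => u' _; rewrite -!mulrA; congr (_ * _).
rewrite mean_cst; last exact: hW.2.
by rewrite !pair_eq_natr; ring.
Qed.

Notation densD := (density joint (fun t : space => t.1.1.1.2)
  (fun t : space => t.1.1.2) (fun t : space => t.1.1.1.1)).

Lemma joint_support x u y x2 z : 0 < joint (x, u, y, x2, z) ->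
  [/\ 0 < p1 x, 0 < W2 x y, 0 < q x y u & 0 < aux_kernel W2 q x u].
Proof.
move=> /lt0r_neq0; rewrite /joint !mulf_eq0 !negb_or -!andbA => /and5P[a b c _ _].
have W0 : 0 < W2 x y by rewrite lt0r b (hW.1 x).1.
have q0 : 0 < q x y u by rewrite lt0r c (hq x y).1.
split=> //; first by rewrite lt0r a hp1.1.
rewrite /aux_kernel (bigD1 y) //= ltr_wpDr ?mulr_gt0 //.
by apply: sumr_ge0 => y' _; rewrite mulr_ge0 ?(hW.1 x).1 ?(hq x y').1.
Qed.

(** The factors [p1 x] and [W2 x y] cancel, leaving p(u|x1,y2) / p(u|x1), the ratio in the change of
    measure. *)
Lemma cover_densityE x u y : 0 < p1 x -> 0 < W2 x y ->
  0 < aux_kernel W2 q x u -> densD u y x = q x y u / aux_kernel W2 q x u.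
Proof.
move=> a b c; rewrite /density marg_UY2X1 marg_X1 marg_UX1 marg_Y2X1.
by field; rewrite !gt_eqF.
Qed.

(** By [ln x <= x - 1] applied to the inverse density, whose mean is at most 1. It keeps the rate of
    auxiliary words nonnegative, as [nmsg_le] requires. *)
Lemma cover_cmi_ge0 : 0 <= cmi joint (fun t : space => t.1.1.1.2)
  (fun t : space => t.1.1.2) (fun t : space => t.1.1.1.1).
Proof.
pose k x u := aux_kernel W2 q x u.
have le_t t : joint t * ((1 - k t.1.1.1.1 t.1.1.1.2 /
     q t.1.1.1.1 t.1.1.2 t.1.1.1.2) / ln 2) <=
   joint t * log2 (densD t.1.1.1.2 t.1.1.2 t.1.1.1.1).
  have [P0|P0] := eqVneq (joint t) 0; first by rewrite P0 !mul0r.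
  have {}P0 : 0 < joint t by rewrite lt0r P0 joint_ge0.
  rewrite ler_pM2l //; case: t P0 => [[[[x u] y] x2] z] /joint_support[a b c d] /=.
  rewrite cover_densityE // /log2 ler_pM2r ?invr_gt0 ?ln2_gt0 //.
  rewrite -[q x y u / _]invf_div lnV ?posrE ?divr_gt0 // lerNr opprB.
  rewrite -[X in ln X](subrKC 1); apply: le_ln1Dx.
  by rewrite ltrBrDl subrr divr_gt0.
rewrite cmi_density; apply: le_trans (ler_sum _ (fun t _ => le_t t)).
under eq_bigr do rewrite mulrA.
rewrite -mulr_suml divr_ge0 ?(ltW (ln2_gt0 _)) //.
under eq_bigr do rewrite mulrBr mulr1.
rewrite sumrB joint_pmf.2 subr_ge0.
rewrite (sum_joint (fun t => k t.1.1.1.1 t.1.1.1.2 /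
     q t.1.1.1.1 t.1.1.2 t.1.1.1.2)) /=.
apply: mean_le_cst => // x; apply: mean_le_cst; first exact: hW.1.
move=> y; rewrite -(aux_kernel_pmf hW hq x).2; apply: ler_sum => u _.
rewrite mean_cst; last exact: hW.2.
(* Where [q] vanishes the left side is 0 while the kernel may be positive, hence only an
   inequality. *)
have [->|q0] := eqVneq (q x y u) 0.
  by rewrite mul0r; exact: (aux_kernel_pmf hW hq x).1.
by rewrite mulrC divfK.
Qed.

End JointLaw.

(** * Blocks of [n] letters as one use of a larger channel *)

Section Block.
Variables (R : realType) (X1 X2 Y2 Y3 U : finType).
Variables (W2 : X1 -> Y2 -> R) (W3 : X1 -> X2 -> Y2 -> Y3 -> R).
Hypothesis hW : relay_channel W2 W3.
Variables (p1 : X1 -> R) (q : X1 -> Y2 -> U -> R) (f : U -> X1 -> Y2 -> X2).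
Hypotheses (hp1 : is_pmf p1) (hq : forall x y, is_pmf (q x y)).
Variable n : nat.

Notation space := (X1 * U * Y2 * X2 * Y3)%type.
Notation P := (joint W2 W3 p1 q f).
Notation blk A := {ffun 'I_n -> A}.

Definition block_p1 (x : blk X1) := \prod_i p1 (x i).
Definition block_W2 (x : blk X1) (y : blk Y2) := \prod_i W2 (x i) (y i).
Definition block_q (x : blk X1) (y : blk Y2) (u : blk U) :=
  \prod_i q (x i) (y i) (u i).
Definition block_W3 (x : blk X1) (x2 : blk X2) (y : blk Y2) (z : blk Y3) :=
  \prod_i W3 (x i) (x2 i) (y i) (z i).
Definition block_f (u : blk U) (x : blk X1) (y : blk Y2) : blk X2 :=
  [ffun i => f (u i) (x i) (y i)].

(** Because the relay sees all of y2 before sending, [n] uses are a single use over block alphabets,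
    to which the one-shot bound applies. *)
Lemma block_channel : relay_channel block_W2 block_W3.
Proof.
split=> [x|x x2 y].
  exact: (prod_pmf (fun i : 'I_n => hW.1 (x i))).
exact: (prod_pmf (fun i : 'I_n => hW.2 (x i) (x2 i) (y i))).
Qed.

Lemma block_p1_pmf : is_pmf block_p1.
Proof. exact: (prod_pmf (fun i : 'I_n => hp1)). Qed.

Lemma block_q_pmf x y : is_pmf (block_q x y).
Proof. exact: (prod_pmf (fun i : 'I_n => hq (x i) (y i))). Qed.

Lemma block_kernel x u : aux_kernel block_W2 block_q x u =
  \prod_i aux_kernel W2 q (x i) (u i).
Proof.
rewrite /aux_kernel bigA_distr_bigA; apply: eq_bigr => y _.
by rewrite -big_split.
Qed.

(** Rewrites the one-shot averages as means over [n] independent copies of [joint], the form needed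
    by the Chebyshev bounds. *)
Lemma block_sum_joint (F : blk X1 -> blk Y2 -> blk U -> blk Y3 -> R) :
  \sum_x block_p1 x * \sum_y block_W2 x y * \sum_u block_q x y u *
    \sum_z block_W3 x (block_f u x y) y z * F x y u z =
  \sum_(t : blk space) \prod_i P (t i) *
    F [ffun i => (t i).1.1.1.1] [ffun i => (t i).1.1.2]
      [ffun i => (t i).1.1.1.2] [ffun i => (t i).2].
Proof.
pose F' (s : blk (X1 * Y2 * U * Y3)) :=
  F [ffun i => (s i).1.1.1] [ffun i => (s i).1.1.2]
    [ffun i => (s i).1.2] [ffun i => (s i).2].
(* The nested sums do not range over [x2], so they are first matched with the law of the other four
   variables, then lifted to [joint]. *)
pose phi (t : space) := (t.1.1.1.1, t.1.1.2, t.1.1.1.2, t.2).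
transitivity (\sum_(s : blk (X1 * Y2 * U * Y3)) \prod_i marg P phi (s i) * F' s).
  pose H (x : blk X1) (y : blk Y2) (u : blk U) (z : blk Y3) :=
    block_p1 x * (block_W2 x y * (block_q x y u *
      (block_W3 x (block_f u x y) y z * F x y u z))).
  transitivity (\sum_x \sum_y \sum_u \sum_z H x y u z).
    apply: eq_bigr => x _; rewrite mulr_sumr; apply: eq_bigr => y _.
    rewrite !mulr_sumr; apply: eq_bigr => u _.
    by rewrite !mulr_sumr; apply: eq_bigr => z _.
  rewrite (sum_ffun_pair (fun x y => \sum_u \sum_z H x y u z)).
  rewrite (sum_ffun_pair (fun s u => \sum_z
    H [ffun i => (s i).1] [ffun i => (s i).2] u z)).
  rewrite sum_ffun_pair; apply: eq_bigr => s _.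
  have e1 : [ffun i => ([ffun i0 => ([ffun i1 => (s i1).1] i0).1] i).1] =
    [ffun i => (s i).1.1.1] :> blk X1 by apply/ffunP => i; rewrite !ffunE.
  have e2 : [ffun i => ([ffun i0 => ([ffun i1 => (s i1).1] i0).1] i).2] =
    [ffun i => (s i).1.1.2] :> blk Y2 by apply/ffunP => i; rewrite !ffunE.
  have e3 : [ffun i => ([ffun i1 => (s i1).1] i).2] =
    [ffun i => (s i).1.2] :> blk U by apply/ffunP => i; rewrite !ffunE.
  rewrite e1 e2 e3 /H -/(F' s) !mulrA; congr (_ * _).
  rewrite /block_p1 /block_W2 /block_q /block_W3 -!big_split /=.
  apply: eq_bigr => i _; rewrite !ffunE.
  by case: (s i) => [[[x y] u] z] /=; rewrite marg_all.
rewrite sum_prod_marg; apply: eq_bigr => t _; congr (_ * F _ _ _ _).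
all: by apply/ffunP => i; rewrite !ffunE.
Qed.

Notation vX1 := (fun t : space => t.1.1.1.1).
Notation vU := (fun t : space => t.1.1.1.2).
Notation vY2 := (fun t : space => t.1.1.2).
Notation vY3 := (fun t : space => t.2).
Notation vX1U := (fun t : space => (t.1.1.1.1, t.1.1.1.2)).
Notation vtt := (fun _ : space => tt).

Let d2 x y := density P vX1 vY2 vtt x y tt.
Let dD u y x := density P vU vY2 vX1 u y x.
Let d3 x u z := density P vX1U vY3 vtt (x, u) z tt.

Definition var2 := pmf_variance P (fun t => log2 (d2 (vX1 t) (vY2 t))).
Definition varD := pmf_variance P (fun t => log2 (dD (vU t) (vY2 t) (vX1 t))).
Definition var3 := pmf_variance P (fun t => log2 (d3 (vX1 t) (vU t) (vY3 t))).

Let I1 := mi P vX1 vY2.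
Let ID := cmi P vU vY2 vX1.
Let I3 := mi P vX1U vY3.

Variables (M L : nat) (eta s : R).
Hypotheses (n_gt0 : (0 < n)%N) (eta_gt0 : 0 < eta) (s_gt0 : 0 < s).

(** Each threshold lies [eta] per letter beyond the mean of its log-density, on the side that makes
    the true words pass: below for [th2] and [th3], above for [tau]. *)
Let th2 := 2 `^ (n%:R * (I1 - eta)).
Let tau := 2 `^ (n%:R * (ID + eta)).
Let th3 := 2 `^ (n%:R * (I3 - eta)).

Definition test2 (x : blk X1) (y : blk Y2) := th2 < \prod_i d2 (x i) (y i).
(** Stated without division, so that it is literally the domination hypothesis [hD]. *)
Definition testD (x : blk X1) (u : blk U) (y : blk Y2) :=
  block_q x y u <= tau * aux_kernel block_W2 block_q x u.
Definition test3 (x : blk X1) (u : blk U) (z : blk Y3) :=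
  th3 < \prod_i d3 (x i) (u i) (z i).

Let hP : is_pmf P := joint_pmf hW f hp1 hq.

Lemma pow2_gt0 (x : R) : 0 < 2 `^ x.
Proof. by apply: powR_gt0; rewrite ltr0n. Qed.

Lemma false_alarm2 y : \sum_x block_p1 x * (test2 x y)%:R <= th2^-1.
Proof.
apply: (threshold_mass_le (w := p1) (d := d2)); first exact: hp1.1.
- by move=> a b; exact: density_ge0.
- move=> b; apply: le_trans (mean_density_le1 vX1 vY2 hP b).
  by apply: ler_sum => x _; rewrite marg_X1.
- exact: pow2_gt0.
Qed.

Lemma false_alarm3 z : \sum_x block_p1 x * \sum_u
   aux_kernel block_W2 block_q x u * (test3 x u z)%:R <= th3^-1.
Proof.
under eq_bigr do rewrite mulr_sumr.
rewrite (sum_ffun_pair (fun x u => block_p1 x *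
   (aux_kernel block_W2 block_q x u * (test3 x u z)%:R))).
have := threshold_mass_le (n := n) (w := fun a => p1 a.1 * aux_kernel W2 q a.1 a.2)
  (d := fun a b => d3 a.1 a.2 b) z (theta := th3).
move=> H; apply: le_trans (H _ _ _ _) => {H}.
- rewrite le_eqVlt; apply/orP; left; apply/eqP; apply: eq_bigr => a _.
  rewrite mulrA block_kernel /block_p1 -big_split /=; congr (_ * _).
    by apply: eq_bigr => i _; rewrite !ffunE.
  rewrite /test3; congr ((_ < _)%R%:R); apply: eq_bigr => i _.
  by rewrite !ffunE.
- move=> a; rewrite mulr_ge0 ?hp1.1 //; exact: (aux_kernel_pmf hW hq _).1.
- by move=> a b; exact: density_ge0.
- move=> b; apply: le_trans (mean_density_le1 vX1U vY3 hP b).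
  by apply: ler_sum => -[x u] _; rewrite marg_X1U.
- exact: pow2_gt0.
Qed.

Lemma miss_prob2 :
  \sum_x block_p1 x * \sum_y block_W2 x y * (~~ test2 x y)%:R <=
  var2 / (n%:R * eta ^+ 2).
Proof.
(* Averages over [u] and [z], each of total mass 1, are inserted so that the full joint law
   appears. *)
have -> : \sum_x block_p1 x * \sum_y block_W2 x y * (~~ test2 x y)%:R =
  \sum_x block_p1 x * \sum_y block_W2 x y * \sum_u block_q x y u *
    \sum_z block_W3 x (block_f u x y) y z * (~~ test2 x y)%:R.
  apply: eq_bigr => x _; congr (_ * _); apply: eq_bigr => y _; congr (_ * _).
  rewrite -[LHS](mean_cst _ (block_q_pmf x y)); apply: eq_bigr => u _.
  by rewrite mean_cst //; exact: block_channel.2.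
rewrite (block_sum_joint (fun x y _ _ => (~~ test2 x y)%:R)).
apply: (ratio_lower_tail (r := fun t => d2 (vX1 t) (vY2 t)) hP) => //.
  by move=> t; exact: (density_gt0 vX1 vY2 vtt hP).
move=> t _; rewrite /test2 -leNgt; congr (_ <= _).
by apply: eq_bigr => i _; rewrite !ffunE.
Qed.

Lemma miss_probD :
  \sum_x block_p1 x * \sum_y block_W2 x y * \sum_u block_q x y u *
     (~~ testD x u y)%:R <= varD / (n%:R * eta ^+ 2).
Proof.
have -> : \sum_x block_p1 x * \sum_y block_W2 x y * \sum_u block_q x y u *
     (~~ testD x u y)%:R =
  \sum_x block_p1 x * \sum_y block_W2 x y * \sum_u block_q x y u *
    \sum_z block_W3 x (block_f u x y) y z * (~~ testD x u y)%:R.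
  apply: eq_bigr => x _; congr (_ * _); apply: eq_bigr => y _; congr (_ * _).
  apply: eq_bigr => u _.
  by rewrite mean_cst //; exact: block_channel.2.
rewrite (block_sum_joint (fun x y u _ => (~~ testD x u y)%:R)).
apply: (ratio_upper_tail (r := fun t => dD (vU t) (vY2 t) (vX1 t)) hP) => //.
  by move=> t; exact: (density_gt0 vU vY2 vX1 hP).
move=> t Pt; rewrite /testD -ltNge block_kernel => /ltW h.
have supp i : [/\ 0 < p1 (vX1 (t i)), 0 < W2 (vX1 (t i)) (vY2 (t i)),
   0 < q (vX1 (t i)) (vY2 (t i)) (vU (t i)) &
   0 < aux_kernel W2 q (vX1 (t i)) (vU (t i))].
  move: (Pt i); case: (t i) => [[[[x u] y] x2] z].
  exact: (joint_support hW hp1 hq).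
have -> : \prod_i dD (vU (t i)) (vY2 (t i)) (vX1 (t i)) =
   (\prod_i q (vX1 (t i)) (vY2 (t i)) (vU (t i))) /
   \prod_i aux_kernel W2 q (vX1 (t i)) (vU (t i)).
  rewrite -prodf_div; apply: eq_bigr => i _; case: (supp i) => a b c d.
  exact: cover_densityE.
rewrite ler_pdivlMr; last by apply: prodr_gt0 => i _; case: (supp i).
move: h; congr (_ * _ <= _).
  by apply: eq_bigr => i _; rewrite !ffunE.
by apply: eq_bigr => i _; rewrite !ffunE.
Qed.

Lemma miss_prob3 :
  \sum_x block_p1 x * \sum_y block_W2 x y * \sum_u block_q x y u *
     miss3 block_W3 block_f test3 x u y <= var3 / (n%:R * eta ^+ 2).
Proof.
rewrite (block_sum_joint (fun x _ u z => (~~ test3 x u z)%:R)).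
apply: (ratio_lower_tail (r := fun t => d3 (vX1 t) (vU t) (vY3 t)) hP) => //.
  by move=> t; exact: (density_gt0 vX1U vY3 vtt hP).
move=> t _; rewrite /test3 -leNgt; congr (_ <= _).
by apply: eq_bigr => i _; rewrite !ffunE.
Qed.

Lemma block_code : (0 < M)%N -> (0 < L)%N -> exists c : nc_code X1 X2 Y2 Y3 n M,
  err_prob W2 W3 c <= var2 / (n%:R * eta ^+ 2) + s + varD / (n%:R * eta ^+ 2) +
    var3 / (n%:R * eta ^+ 2) / s + tau / L%:R + M%:R * (th2^-1 + L%:R * th3^-1).
Proof.
move=> M0 L0; pose m0 : 'I_M := Ordinal M0; pose l0 : 'I_L := Ordinal L0.
have inv0 x : 0 <= (2 `^ x)^-1 :> R by rewrite invr_ge0 ltW ?pow2_gt0.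
have [c hc] := one_shot_code block_channel block_p1_pmf block_q_pmf
  m0 l0 s_gt0 (pow2_gt0 _) (inv0 _) (inv0 _) (fun x u y (h : testD x u y) => h)
  false_alarm2 false_alarm3 miss_prob2 miss_probD miss_prob3.
exists (NCCode (fun m => (c m).1)
  (fun i y => relay_input block_W3 block_f m0 l0 test2 testD test3 s c y i)
  (decoder test3 c)).
apply: le_trans hc; rewrite le_eqVlt; apply/orP; left; apply/eqP.
rewrite /err_prob; congr (_ * _); apply: eq_bigr => m _; apply: eq_bigr => y _.
rewrite mulr_sumr; apply: eq_bigr => z _ /=.
by rewrite -mulrA; congr (_ * (_ * _)); case: (_ == _).
Qed.

End Block.

(** * Choice of rates and vanishing error *)

Lemma pow2D (R : realType) (x y : R) : 2 `^ (x + y) = 2 `^ x * 2 `^ y.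
Proof. by rewrite powRD // pnatr_eq0 implybT. Qed.

Lemma pow2_ge1Dx (R : realType) (x : R) : 1 + x * ln 2 <= 2 `^ x.
Proof. by rewrite /powR pnatr_eq0 /= expR_ge1Dx. Qed.

Lemma nmsg_ge (R : realType) (r : R) n : 2 `^ (n%:R * r) <= (nmsg r n)%:R.
Proof.
have c0 : (0 <= Num.ceil (2 `^ (n%:R * r)))%R.
  by rewrite ceil_ge0 (lt_trans _ (pow2_gt0 _)) // ltrN10.
by rewrite /nmsg natr_absz ger0_norm // ceil_ge.
Qed.

Lemma nmsg_gt0 (R : realType) (r : R) n : (0 < nmsg r n)%N.
Proof. by rewrite -(ltr0n R) (lt_le_trans (pow2_gt0 _) (nmsg_ge _ _)). Qed.

(** The ceiling adds at most 1, and 1 is at most the power because the rate is nonnegative. *)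
Lemma nmsg_le (R : realType) (r : R) n : 0 <= r ->
  (nmsg r n)%:R <= 2 * 2 `^ (n%:R * r).
Proof.
move=> r0; set x := 2 `^ _; have x1 : 1 <= x.
  by rewrite -(powRr0 2) ler_pow2 mulr_ge0.
have c0 : (0 <= Num.ceil x)%R.
  by rewrite ceil_ge0 (lt_le_trans _ x1) // (lt_trans ltrN10).
rewrite /nmsg -/x natr_absz ger0_norm //.
by have := ceilB1_lt x; rewrite intrB; lra.
Qed.

Lemma err_prob_ge0 (R : realType) (X1 X2 Y2 Y3 : finType)
    (W2 : X1 -> Y2 -> R) (W3 : X1 -> X2 -> Y2 -> Y3 -> R)
    (hW : relay_channel W2 W3) n M (c : nc_code X1 X2 Y2 Y3 n M) :
  0 <= err_prob W2 W3 c.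
Proof.
rewrite /err_prob mulr_ge0 ?invr_ge0 ?ler0n //; do 3![apply: sumr_ge0 => ? _].
rewrite !mulr_ge0 //; last by case: ifP.
  by apply: prodr_ge0 => i _; exact: (hW.1 _).1.
by apply: prodr_ge0 => i _; exact: (hW.2 _ _ _).1.
Qed.

Lemma pmf_inhabited (R : realType) (T : finType) (p : T -> R) :
  is_pmf p -> inhabited T.
Proof.
move=> [_ p1]; have [t|T0] := pickP (@predT T); first by exists.
by move/eqP: p1; rewrite big_pred0 // eq_sym oner_eq0.
Qed.

Section Rates.
Variables (R : realType) (X1 X2 Y2 Y3 U : finType).
Variables (W2 : X1 -> Y2 -> R) (W3 : X1 -> X2 -> Y2 -> Y3 -> R).
Hypothesis hW : relay_channel W2 W3.
Variables (p1 : X1 -> R) (q : X1 -> Y2 -> U -> R) (f : U -> X1 -> Y2 -> X2).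
Hypotheses (hp1 : is_pmf p1) (hq : forall x y, is_pmf (q x y)).

Notation space := (X1 * U * Y2 * X2 * Y3)%type.
Notation P := (joint W2 W3 p1 q f).
Notation vX1 := (fun t : space => t.1.1.1.1).
Notation vU := (fun t : space => t.1.1.1.2).
Notation vY2 := (fun t : space => t.1.1.2).
Notation vY3 := (fun t : space => t.2).
Notation vX1U := (fun t : space => (t.1.1.1.1, t.1.1.1.2)).

Lemma inputs_inhabited : inhabited (X1 * X2).
Proof.
have [x] := pmf_inhabited hp1; have [y] := pmf_inhabited (hW.1 x).
by have [u] := pmf_inhabited (hq x y); exists; exact: (x, f u x y).
Qed.

(** At rate 0 there is exactly one message, and a decoder that always announces it never errs. *)
Lemma achievable0 : achievable W2 W3 0.
Proof.
split=> //; have [[x x2]] := inputs_inhabited.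
pose c n : nc_code X1 X2 Y2 Y3 n (nmsg 0 n) :=
  NCCode (fun _ => [ffun => x]) (fun _ _ => x2)
    (fun _ => [pick m : 'I_(nmsg (0 : R) n)]).
exists c; suff -> : (fun n => err_prob W2 W3 (c n)) = fun=> 0 by exact: cvg_cst.
apply/funext => n; rewrite /err_prob big1 ?mulr0 // => m _.
rewrite big1 // => y _; rewrite big1 // => z _.
rewrite [X in _ * X]ifT ?mulr0 //=; case: pickP => [m' _|/(_ m)] //.
apply/eqP; congr Some; apply/val_inj.
have M1 : nmsg (0 : R) n = 1%N.
  by rewrite /nmsg mulr0 powRr0 -[1]/(1%:~R) intrKceil.
by move: m m'; rewrite M1 => m m'; rewrite (ord1 m) (ord1 m').
Qed.

Variable Rt : R.
Hypothesis Rt_ge0 : 0 <= Rt.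
Hypothesis Rt_lt1 : Rt < mi P vX1 vY2.
Hypothesis Rt_lt2 : Rt < mi P vX1U vY3 - cmi P vU vY2 vX1.

Lemma rate_code : exists K : R, forall n : nat,
  exists c : nc_code X1 X2 Y2 Y3 n (nmsg Rt n),
  (0 < n)%N -> err_prob W2 W3 c <= K / Num.sqrt n%:R.
Proof.
move: Rt_lt1 Rt_lt2; set I1 := mi P vX1 vY2; set I3 := mi P vX1U vY3.
set ID := cmi P vU vY2 vX1 => lt1 lt2.
have ID0 : 0 <= ID by exact: cover_cmi_ge0.
(* A quarter of the smaller gap: the confusion exponent at the receiver loses [2 * eta] to the
   excess rate of the words and [eta] to the threshold, leaving [eta]. *)
pose eta : R := Num.min (I1 - Rt) (I3 - ID - Rt) / 4.
have eta0 : 0 < eta by rewrite divr_gt0 // lt_min !subr_gt0 lt1.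
have gap1 : Rt + 4 * eta <= I1.
  by rewrite /eta mulrC divfK ?pnatr_eq0 // -lerBrDl ge_min lexx.
have gap2 : Rt + 4 * eta <= I3 - ID.
  by rewrite /eta mulrC divfK ?pnatr_eq0 // -lerBrDl ge_min lexx orbT.
clearbody eta.
pose V2 := var2 W2 W3 p1 q f; pose VD := varD W2 W3 p1 q f.
pose V3 := var3 W2 W3 p1 q f.
have hP : is_pmf P by exact: joint_pmf.
have V20 : 0 <= V2 by exact: pmf_variance_ge0.
have VD0 : 0 <= VD by exact: pmf_variance_ge0.
have V30 : 0 <= V3 by exact: pmf_variance_ge0.
have l2 : 0 < ln 2 :> R by exact: ln2_gt0.
(* The 1 accounts for the tolerance [s], and 7 = 1 + 2 + 4 collects the exponential terms [h1],
   [h2], [h3], the factors 2 and 4 coming from ceilings. *)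
exists ((V2 + VD + V3) / eta ^+ 2 + 1 + 7 / (eta * ln 2)) => -[|n'].
  have [[x x2]] := inputs_inhabited.
  by exists (NCCode (fun _ => [ffun => x]) (fun _ _ => x2) (fun _ => None)).
set n := n'.+1; pose N : R := n%:R; have N0 : 0 < N by rewrite ltr0n.
(* [w] serves as the tolerance [s]: it balances [s] against the term of order 1 / (n s), both then
   being of order [w]. *)
pose w : R := (Num.sqrt N)^-1.
have w0 : 0 < w by rewrite invr_gt0 sqrtr_gt0.
have wN : N^-1 = w ^+ 2 by rewrite exprVn sqr_sqrtr // ltW.
have w1 : w <= 1.
  rewrite invf_le1 ?sqrtr_gt0 // -[leLHS]sqrtr1 ler_wsqrtr //.
  by rewrite ler1n.
have [c hc] := block_code hW f hp1 hq (n := n) (M := nmsg Rt n)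
  (L := nmsg (ID + 2 * eta) n) (ltn0Sn n') eta0 w0 (nmsg_gt0 _ _) (nmsg_gt0 _ _).
exists c => _; apply: (le_trans hc) => {hc}; rewrite -/V2 -/VD -/V3 -/I1 -/I3 -/ID.
rewrite -/N -/w; set M := (nmsg Rt n)%:R; set L := (nmsg _ n)%:R.
pose e := 2 `^ (- (N * eta)).
have e_le : e <= w ^+ 2 / (eta * ln 2).
  rewrite -wN -invfM /e powRN lef_pV2 ?posrE ?pow2_gt0 ?mulr_gt0 //.
  by apply: le_trans (pow2_ge1Dx _); rewrite -mulrA lerDr ler01.
have e0 : 0 < e by exact: pow2_gt0.
have M0 : 0 <= M by exact: ler0n.
have hM : M <= 2 * 2 `^ (N * Rt) by exact: nmsg_le.
have L0 : 0 < L by rewrite ltr0n nmsg_gt0.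
have Lge : 2 `^ (N * (ID + 2 * eta)) <= L by exact: nmsg_ge.
have hL : L <= 2 * 2 `^ (N * (ID + 2 * eta)).
  by apply: nmsg_le; rewrite addr_ge0 // mulr_ge0 // ltW.
have h1 : 2 `^ (N * (ID + eta)) / L <= e.
  rewrite ler_pdivrMr //; apply: le_trans (_ : e * 2 `^ (N * (ID + 2 * eta)) <= _).
    by rewrite -pow2D ler_pow2; lra.
  by rewrite ler_pM2l.
have h2 : M * (2 `^ (N * (I1 - eta)))^-1 <= 2 * e.
  rewrite -powRN; apply: le_trans (_ : 2 * 2 `^ (N * Rt) * 2 `^ (- (N * (I1 - eta))) <= _).
    by rewrite ler_wpM2r // ltW // pow2_gt0.
  rewrite -mulrA -pow2D ler_pM2l // ler_pow2.
  have := ler_wpM2l (ltW N0) gap1; have := mulr_gt0 N0 eta0; lra.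
have h3 : M * (L * (2 `^ (N * (I3 - eta)))^-1) <= 4 * e.
  rewrite -powRN; apply: le_trans (_ : 2 * 2 `^ (N * Rt) *
    (2 * 2 `^ (N * (ID + 2 * eta)) * 2 `^ (- (N * (I3 - eta)))) <= _).
    have p0 : 0 < 2 `^ (- (N * (I3 - eta))) :> R by exact: pow2_gt0.
    by apply: ler_pM => //; rewrite ?mulr_ge0 ?(ltW L0) ?(ltW p0) // ler_wpM2r // ltW.
  have -> : 2 * 2 `^ (N * Rt) *
    (2 * 2 `^ (N * (ID + 2 * eta)) * 2 `^ (- (N * (I3 - eta)))) =
    4 * 2 `^ (N * Rt + N * (ID + 2 * eta) + - (N * (I3 - eta))).
    by rewrite !pow2D; ring.
  rewrite ler_pM2l // ler_pow2.
  have := ler_wpM2l (ltW N0) gap2; lra.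
have var_eq (V : R) : V / (N * eta ^+ 2) = V / eta ^+ 2 * w ^+ 2.
  by rewrite -wN; field; rewrite !gt_eqF.
rewrite !var_eq [M * _]mulrDr.
have -> : V3 / eta ^+ 2 * w ^+ 2 / w = V3 / eta ^+ 2 * w.
  by field; rewrite !gt_eqF.
have w2 : w ^+ 2 <= w by rewrite expr2 ler_piMl // ltW.
have le_w (a : R) : 0 <= a -> a * w ^+ 2 <= a * w by move=> a0; rewrite ler_wpM2l.
have ei : 0 < eta ^+ 2 by rewrite exprn_gt0.
have a2 := le_w (V2 / eta ^+ 2) (divr_ge0 V20 (ltW ei)).
have aD := le_w (VD / eta ^+ 2) (divr_ge0 VD0 (ltW ei)).
have a7 : 7 * e <= 7 / (eta * ln 2) * w.
  rewrite -mulrA ler_pM2l //; apply: (le_trans e_le); rewrite mulrC.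
  by rewrite ler_pM2l // invr_gt0 mulr_gt0.
have -> : ((V2 + VD + V3) / eta ^+ 2 + 1 + 7 / (eta * ln 2)) * w =
  V2 / eta ^+ 2 * w + VD / eta ^+ 2 * w + V3 / eta ^+ 2 * w + w +
  7 / (eta * ln 2) * w by ring.
(* The remaining nonlinear terms enter only linearly, so they are generalized to variables. *)
move: a2 aD a7 h1 h2 h3.
move: (V2 / _ * w) (V2 / _ * w ^+ 2) (VD / _ * w) (VD / _ * w ^+ 2) => b1 b2 b3 b4.
move: (V3 / _ * w) (7 / _ * w) (_ / L) (M * _^-1) (M * (L * _)) => b5 b6 b7 b8 b9.
by lra.
Qed.

Lemma rate_achievable : achievable W2 W3 Rt.
Proof.
split=> //; have [K hK] := rate_code.
exists (fun n => sval (cid (hK n))).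
apply/cvgr0Pnorm_lt => e e0.
near=> n.
have n0 : (0 < n)%N by near: n; exact: nbhs_infty_gt.
have hn : (K / e) ^+ 2 < n%:R :> R by near: n; exact: nbhs_infty_gtr.
case: cid => c hc /=; rewrite ger0_norm ?err_prob_ge0 //.
apply: (le_lt_trans (hc n0)).
have r0 : 0 < Num.sqrt n%:R :> R by rewrite sqrtr_gt0 ltr0n.
rewrite ltr_pdivrMr // mulrC -ltr_pdivrMr //.
apply: (le_lt_trans (ler_norm _)).
by rewrite -sqrtr_sqr ltr_sqrt // ltr0n.
Unshelve. all: by end_near. Qed.

End Rates.

(** * From achievable rates to capacity *)

Theorem theorem1 (R : realType) (X1 X2 Y2 Y3 U : finType)
  (W2 : X1 -> Y2 -> R) (W3 : X1 -> X2 -> Y2 -> Y3 -> R)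
  (hW : relay_channel W2 W3)
  (p1 : X1 -> R) (hp1 : is_pmf p1)
  (q : X1 -> Y2 -> U -> R) (hq : forall x1 y2, is_pmf (q x1 y2))
  (f : U -> X1 -> Y2 -> X2) :
  let P : (X1 * U * Y2 * X2 * Y3)%type -> R :=
    fun t => let: (x1, u, y2, x2, y3) := t in
      p1 x1 * W2 x1 y2 * q x1 y2 u * (if x2 == f u x1 y2 then 1 else 0)
      * W3 x1 x2 y2 y3 in
  let X1v := fun t : (X1 * U * Y2 * X2 * Y3)%type => t.1.1.1.1 in
  let Uv  := fun t : (X1 * U * Y2 * X2 * Y3)%type => t.1.1.1.2 in
  let Y2v := fun t : (X1 * U * Y2 * X2 * Y3)%type => t.1.1.2 in
  let Y3v := fun t : (X1 * U * Y2 * X2 * Y3)%type => t.2 in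
  ((Num.min (mi P X1v Y2v)
            (mi P (fun t => (X1v t, Uv t)) Y3v - cmi P Uv Y2v X1v))%:E
   <= capacity W2 W3)%E.
Proof.
cbv zeta; set m := Num.min _ _.
have ach r : achievable W2 W3 r -> (r%:E <= capacity W2 W3)%E.
  by move=> hr; apply: ereal_sup_ubound; exists r.
have [m0|m0] := leP m 0.
  by apply: le_trans (ach 0 (achievable0 hW f hp1 hq)); rewrite lee_fin.
(* Only rates strictly below [m] are shown achievable, so the supremum is approached by [m - e].
   When that is not positive, rate 0 takes over, as achievable rates must be nonnegative. *)
apply/lee_subgt0Pr => e e0; rewrite -EFinB.
have [me|me] := leP (m - e) 0.
  by apply: le_trans (ach 0 (achievable0 hW f hp1 hq)); rewrite lee_fin.
have lt_m : m - e < m by rewrite ltrBlDr ltrDl.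
apply: ach; apply: (rate_achievable hW hp1 hq (f := f) (ltW me)).
  by apply: (lt_le_trans lt_m); rewrite ge_min lexx.
by apply: (lt_le_trans lt_m); rewrite ge_min lexx orbT.
Qed.
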